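(* For every instance of $P2,S1|s_j,t_j|C_{max}$ with jobs $J_1,\dots,J_n$, the quantity $$LB_1=\frac{\min_{1\le j\le n}s_j+\sum_{j=1}^{n}A_j+\min_{1\le j\le n}t_j}{2}$$ is a valid lower bound for the problem, i.e. every feasible schedule has makespan $C_{max}\ge LB_1$.
   Context: Problem $P2,S1|s_j,t_j|C_{max}$: there are $n\geq 1$ independent jobs $J_1,\dots,J_n$, all available at time $0$, each with loading time $s_j>0$, integer processing time $p_j>0$ and unloading time $t_j>0$; two identical parallel machines; and one server. Each job is assigned to one machine, where it is loaded by the server, then processed, then unloaded by the server, with no delay between loading and processing nor between processing and unloading. A machine handles at most one job at a time and is occupied throughout loading, processing and unloading; the server performs at most one loading or unloading operation at a time. No preemption. The objective is to minimize the makespan $C_{max}$ (the largest time at which the unloading of a job ends). $A_j=s_j+p_j+t_j$ is the length of job $J_j$. *)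

(* Defs.v *)
From mathcomp Require Import all_boot all_order all_algebra.

Set Implicit Arguments.
Unset Strict Implicit.
Unset Printing Implicit Defensive.

Import Order.TTheory GRing.Theory Num.Theory.
Local Open Scope ring_scope.

(* Loading and unloading times are arbitrary positive numbers of R; only the
   processing times are required to be integers. *)
Record instance (R : realFieldType) (n : nat) := Instance {
  load_time : 'I_n -> R;
  proc_time : 'I_n -> nat;
  unload_time : 'I_n -> R;
  load_time_gt0 : forall j, 0 < load_time j;
  proc_time_gt0 : forall j, (0 < proc_time j)%N;
  unload_time_gt0 : forall j, 0 < unload_time j }.

Definition job_length (R : realFieldType) (n : nat) (X : instance R n)
    (j : 'I_n) : R :=
  load_time X j + (proc_time X j)%:R + unload_time X j.

Record schedule (R : realFieldType) (n : nat) := Schedule {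
  machine : 'I_n -> 'I_2;
  load_start : 'I_n -> R;
  proc_start : 'I_n -> R;
  unload_start : 'I_n -> R }.

Inductive server_op := Load | Unload.

Section Feasibility.
Variables (R : realFieldType) (n : nat) (X : instance R n) (S : schedule R n).

Definition op_start (o : server_op) (j : 'I_n) : R :=
  match o with Load => load_start S j | Unload => unload_start S j end.

Definition op_end (o : server_op) (j : 'I_n) : R :=
  match o with
  | Load => load_start S j + load_time X j
  | Unload => unload_start S j + unload_time X j
  end.

Definition completion (j : 'I_n) : R := op_end Unload j.

(* The time intervals [a, b) and [c, d), both nonempty, do not overlap; one may
   start exactly when the other ends. *)
Definition no_overlap (a b c d : R) : Prop := b <= c \/ d <= a.

Record feasible : Prop := Feasible {
  available_at_0 : forall j, 0 <= load_start S j;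
  no_delay_proc : forall j, proc_start S j = load_start S j + load_time X j;
  no_delay_unload :
    forall j, unload_start S j = proc_start S j + (proc_time X j)%:R;
  machine_capacity : forall i j, i <> j -> machine S i = machine S j ->
    no_overlap (load_start S i) (completion i) (load_start S j) (completion j);
  server_capacity : forall o i o' j, (o, i) <> (o', j) ->
    no_overlap (op_start o i) (op_end o i) (op_start o' j) (op_end o' j) }.

End Feasibility.

(* Since there is at least one job, the value at [ord0] is a neutral choice of
   default for the minima and maxima below. *)
Definition makespan (R : realFieldType) (n : nat) (X : instance R n.+1)
    (S : schedule R n.+1) : R :=
  \big[Num.max/completion X S ord0]_(j < n.+1) completion X S j.

Definition LB1 (R : realFieldType) (n : nat) (X : instance R n.+1) : R :=
  (\big[Num.min/load_time X ord0]_(j < n.+1) load_time X j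
   + \sum_(j < n.+1) job_length X j
   + \big[Num.min/unload_time X ord0]_(j < n.+1) unload_time X j) / 2.

(* Main.v *)
Require Import Defs.
From mathcomp Require Import all_boot all_order all_algebra.
From mathcomp Require Import lra.
Import Order.TTheory GRing.Theory Num.Theory.
Local Open Scope ring_scope.

(** Let [C] be the makespan. Each machine could be busy during all of [[0, C]],
    which only gives half the total job length as a bound. The two minima come
    from the server. Let [a] be the job whose loading starts first: while the
    server loads [a], it can load nothing on the other machine, so that machine
    is idle until time [min s] at least. Symmetrically, let [c] be the job that
    completes last: while the server unloads [c], it can unload nothing on the
    machine not holding [c], so that machine is idle from [C - min t] on.
    Whether or not [a] and [c] share a machine, the two machines together
    have windows of total length [2 C - min s - min t]
    ([sum_machine_windows]), and disjoint jobs inside a window have total length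
    at most that of the window ([packing]). A machine without jobs is no
    exception, provided that its window has nonnegative length; this holds
    because some job is loaded and unloaded within [[0, C]]. *)

(** The interval that starts last lies to the right of all the others, so
    removing it leaves a packing of a shorter window, ending at its start.
    The hypothesis [lo <= hi] serves the base case, the empty family. *)
Lemma packing (R : realFieldType) (I : finType) (b e : I -> R) (A : {set I})
    (lo hi : R) :
  (forall i, b i < e i) ->
  {in A &, forall i j, i <> j -> no_overlap (b i) (e i) (b j) (e j)} ->
  {in A, forall i, lo <= b i /\ e i <= hi} ->
  lo <= hi ->
  \sum_(i in A) (e i - b i) <= hi - lo.
Proof.
move=> be.
elim: {A}#|A| {-2}A (erefl #|A|) hi => [|k IHk] A cardA hi sepA winA le_lohi.
  by move/eqP: cardA; rewrite cards_eq0 => /eqP->; rewrite big_set0 subr_ge0.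
have [i0 i0A] : exists i, i \in A by apply/card_gt0P; rewrite cardA.
case: (@arg_maxP _ _ _ i0 (fun i => i \in A) b i0A) => i iA b_max.
have [lo_bi ei_hi] := winA i iA.
rewrite (big_setD1 i iA) /=.
suff: \sum_(j in A :\ i) (e j - b j) <= b i - lo by lra.
apply: IHk => //.
- by move: cardA; rewrite (cardsD1 i) iA => -[].
- by move=> j l /setD1P[_ jA] /setD1P[_ lA]; apply: sepA.
move=> j /setD1P[/eqP ji jA]; split; first by have [] := winA j jA.
have [//|ei_bj] := sepA j i jA iA ji.
have /= bj_bi := b_max j jA; have bei := be i; lra.
Qed.

Lemma sum_machine_windows (R : realFieldType) (m1 m2 : 'I_2) (C s t : R) :
  \sum_(m < 2) ((if m == m2 then C else C - t) - (if m == m1 then 0 else s))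
  = C *+ 2 - s - t.
Proof.
rewrite big_ord_recl big_ord1.
by case: m1 m2 => -[|[|//]] ? [] [|[|//]] ?; rewrite -!val_eqE /=; lra.
Qed.

Section FeasibleSchedule.

Context {R : realFieldType} {n : nat} {X : instance R n} {S : schedule R n}.
Hypothesis feasS : feasible X S.

Lemma completionE j : completion X S j = load_start S j + job_length X j.
Proof.
by rewrite /completion /= (no_delay_unload feasS) (no_delay_proc feasS)
  /job_length !addrA.
Qed.

Lemma job_lengthE j : job_length X j = completion X S j - load_start S j.
Proof. by rewrite completionE addrC addKr. Qed.

Lemma lt_load_start_completion j : load_start S j < completion X S j.
Proof.
rewrite completionE /job_length.
have := load_time_gt0 X j; have := unload_time_gt0 X j.
have : 0 <= (proc_time X j)%:R :> R by exact: ler0n.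
lra.
Qed.

(** Were [j] loaded before [a] by the server, it would start strictly earlier,
    as loading times are positive; so the server has already spent the loading
    time of [a] when [j] starts. *)
Lemma load_after_first a j :
  (forall i, load_start S a <= load_start S i) -> j <> a ->
  load_time X a <= load_start S j.
Proof.
move=> a_first ja.
have aj : (Load, a) <> (Load, j) by case=> /esym.
have := available_at_0 feasS a; have := a_first j.
have := load_time_gt0 X j.
by case: (server_capacity feasS aj) => /=; lra.
Qed.

(** The time reversal of [load_after_first]. *)
Lemma unload_before_last c j :
  (forall i, completion X S i <= completion X S c) -> j <> c ->
  completion X S j <= completion X S c - unload_time X c.
Proof.
move=> c_last jc.
have cj : (Unload, c) <> (Unload, j) by case=> /esym.
have := c_last j; rewrite /completion /=.
have := unload_time_gt0 X j.
by case: (server_capacity feasS cj) => /=; lra.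
Qed.

End FeasibleSchedule.

Theorem proposition8 (R : realFieldType) (n : nat) (X : instance R n.+1)
    (S : schedule R n.+1) :
  feasible X S -> LB1 X <= makespan X S.
Proof.
move=> feasS; rewrite /LB1.
set s := \big[_/_]_(j < _) load_time X j.
set t := \big[_/_]_(j < _) unload_time X j.
set C := makespan X S.
have s_le j : s <= load_time X j by exact: bigmin_le.
have t_le j : t <= unload_time X j by exact: bigmin_le.
have le_C j : completion X S j <= C by exact: le_bigmax.
have s_ge0 : 0 <= s by apply/le_bigmin => [|j _]; apply/ltW/load_time_gt0.
have t_ge0 : 0 <= t by apply/le_bigmin => [|j _]; apply/ltW/unload_time_gt0.
(* The windows have nonnegative length, even on a machine without jobs. *)
have stC : s + t <= C.
  have := le_C ord0; rewrite (completionE feasS) /job_length.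
  have := available_at_0 feasS ord0; have := s_le ord0; have := t_le ord0.
  have : 0 <= (proc_time X ord0)%:R :> R by exact: ler0n.
  lra.
have [a a_first] : exists a, forall i, load_start S a <= load_start S i.
  case: (@arg_minP _ _ _ ord0 predT (load_start S) isT) => a _ a_min.
  by exists a => i; apply: a_min.
have [c c_last] : exists c, forall i, completion X S i <= completion X S c.
  case: (@arg_maxP _ _ _ ord0 predT (completion X S) isT) => c _ c_max.
  by exists c => i; apply: c_max.
pose lo (m : 'I_2) := if m == machine S a then 0 else s.
pose hi (m : 'I_2) := if m == machine S c then C else C - t.
have machine_load m :
    \sum_(j in [set j | machine S j == m]) job_length X j <= hi m - lo m.
  under eq_bigr => j _ do rewrite (job_lengthE feasS).
  apply: packing.
  - exact: lt_load_start_completion.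
  - move=> i j; rewrite !inE => /eqP im /eqP jm ij.
    by apply: machine_capacity ij _ => //; rewrite im jm.
  - move=> j; rewrite inE /lo /hi => /eqP <-; split.
      case: eqP => [_|ja]; first exact: available_at_0 feasS j.
      apply: le_trans (s_le a) _; apply: load_after_first => // ja'.
      by rewrite ja' in ja.
    case: eqP => [_|jc]; first exact: le_C.
    have jc' : j <> c by move=> jc'; rewrite jc' in jc.
    have := unload_before_last feasS _ _ c_last jc'; have := t_le c; have := le_C c.
    lra.
  - by rewrite /lo /hi; do 2![case: ifP => _]; lra.
have total : \sum_(j < n.+1) job_length X j <= C *+ 2 - s - t.
  rewrite -(sum_machine_windows _ (machine S a) (machine S c)).
  rewrite (partition_big (machine S) predT) //=; apply: ler_sum => m _.
  by have := machine_load m; rewrite big_set.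
lra.
Qed.
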